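(* Let $m\ge 1$ be an integer, let $\mathbf t=(t_0,\dots,t_{m-1})$ be an $m$-tuple of positive real numbers, and let $\Psi:\mathbb N\to\mathbb R_{\ge 1}$ be a function. Put $$\mathcal E_{\mathbf t}(\Psi)=\Big\{x\in[0,1):\ \prod_{i=0}^{m-1}a_{n+i}(x)^{t_i}\ge \Psi(n)\ \text{for infinitely many } n\in\mathbb N\Big\},$$ $$t_{\max}=\max\{t_i:0\le i\le m-1\},\qquad \ell=\#\{i: t_i=t_{\max}\}.$$ Then the Lebesgue measure $\mathcal L(\mathcal E_{\mathbf t}(\Psi))$ satisfies $$\mathcal L(\mathcal E_{\mathbf t}(\Psi))=\begin{cases}0 & \text{if } \sum_{n=1}^\infty \frac{(\log\Psi(n))^{\ell-1}}{\Psi(n)^{1/t_{\max}}}<\infty,\\[1ex] 1 & \text{if } \sum_{n=1}^\infty \frac{(\log\Psi(n))^{\ell-1}}{\Psi(n)^{1/t_{\max}}}=\infty.\end{cases}$$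
   Context: $\mathbb N=\{1,2,3,\dots\}$ and $\mathbb R_{\ge1}=[1,\infty)$. For $x\in[0,1)$, $a_1(x),a_2(x),\ldots\in\mathbb N$ denote the partial quotients of the regular continued fraction expansion $x=[a_1(x),a_2(x),\dots]=1/(a_1(x)+1/(a_2(x)+\cdots))$. (Rational $x$ have finite expansions; they form a null set.)
   Formalization: In the convergence case with ℓ ≥ 2, Ψ(n) is also assumed to be eventually at least some c > 1; without this the claim fails, e.g. for m = 2, t = (1,1), Ψ = 1, where the series is 0 but the set has measure 1. *)

(* Defs.v *)
From HB Require Import structures.
From mathcomp Require Import all_boot all_order all_algebra.
From mathcomp Require Import all_classical all_reals all_analysis.

Set Implicit Arguments.
Unset Strict Implicit.
Unset Printing Implicit Defensive.

Import Order.TTheory GRing.Theory Num.Theory.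
Import numFieldNormedType.Exports.

Local Open Scope classical_set_scope.
Local Open Scope ring_scope.

(* The tail map [a1, a2, a3, ...] |-> [a2, a3, ...] on [0, 1).  Since 0^-1 = 0,
   it sends 0 to 0. *)
Definition gauss_map (R : realType) (x : R) : R :=
  x^-1 - (Num.floor x^-1)%:~R.

(* The n-th partial quotient of x in [0, 1), indexed from n = 1 (n = 0 is not
   meaningful).  If the expansion of x ends before its n-th term, the value is
   0, whereas genuine partial quotients are >= 1. *)
Definition partial_quotient (R : realType) (n : nat) (x : R) : nat :=
  Num.truncn (iter n.-1 (@gauss_map R) x)^-1.

Definition weighted_product (R : realType) (m : nat) (t : m.-tuple R)
    (n : nat) (x : R) : R :=
  \prod_(i < m) (partial_quotient (n + i) x)%:R `^ tnth t i.

(* Points with a finite expansion do not belong to this set when m and the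
   entries of t are positive: the product is eventually 0 < 1 <= Psi n. *)
Definition limsup_set (R : realType) (m : nat) (t : m.-tuple R)
    (Psi : nat -> R) : set R :=
  [set x : R | 0 <= x < 1 /\
    infinite_set [set n : nat | (0 < n)%N /\ Psi n <= weighted_product t n x]].

(* The default value 0 is harmless: t is a nonempty tuple of positive reals. *)
Definition tmax (R : realType) (m : nat) (t : m.-tuple R) : R :=
  \big[Num.max/0]_(i < m) tnth t i.

Definition tmax_mult (R : realType) (m : nat) (t : m.-tuple R) : nat :=
  #|[pred i : 'I_m | tnth t i == tmax t]|.

(* The exponent tmax_mult t - 1 is a natural number, and 0 ^ 0 = 1.
   Pitfall: when tmax_mult t > 1 the terms with Psi n = 1 vanish.  For Psi = 1
   the series then converges although limsup_set t Psi contains every irrational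
   of [0, 1); the convergence half of the zero-one law therefore needs Psi to be
   eventually bounded away from 1 when tmax_mult t > 1. *)
Definition weighted_series (R : realType) (m : nat) (t : m.-tuple R)
    (Psi : nat -> R) : \bar R :=
  (\sum_(1 <= n <oo)
     (ln (Psi n) ^+ (tmax_mult t).-1 / Psi n `^ (tmax t)^-1)%:E)%E.

(* Main.v *)
(* If x in (0, 1] has density (1 + g) / (1 + g x)^2 with g in [0, 1], then, given
   its first partial quotient a, the tail of x has the density of the same form
   with parameter 1 / (a + g), and P (first digit = a) lies between p a / 2 and
   2 p a, where p a = 1 / (a (a + 1)).  The digits thus form a chain in which
   every conditional estimate can be made uniform in g.

   Normalize the exponents by t_max and put X = Psi^(1/t_max).  One digit at a
   time, the probability that the product of m consecutive digits reaches X is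
   comparable to (log X)^(l-1) / X for large X, uniformly in the past: each
   exponent 1 beyond the first contributes sum_(a <= X) 1/a ~ log X, and an
   exponent s < 1 costs only the constant sum_a a^s p a.

   Convergence is then the Borel-Cantelli lemma.  For divergence, some residue
   class modulo m carries a large part of the series on a long window; along it
   the events involve disjoint blocks of digits, so the probability that none
   of them occurs is at most a product of (1 - c b_n), which tends to 0. *)

Require Import Defs.
From HB Require Import structures.
From mathcomp Require Import all_boot all_order all_algebra.
From mathcomp Require Import all_classical all_reals all_analysis.
From mathcomp Require Import measurable_realfun ring lra.

Set Implicit Arguments.
Unset Strict Implicit.
Unset Printing Implicit Defensive.

Import Order.TTheory GRing.Theory Num.Theory.
Import numFieldNormedType.Exports.

Local Open Scope classical_set_scope.
Local Open Scope ring_scope.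

(** * Lebesgue measure under decreasing affine maps and modulo countable sets *)

Section LebesgueComplements.
Context {R : realType}.
Implicit Types A B N : set R.

Lemma measurable_affine (b w : R) :
  measurable_fun [set: R] (fun y : R => (b - y) / w).
Proof.
apply: measurable_funM; last exact: measurable_cst.
by apply: measurable_funB; [exact: measurable_cst|exact: measurable_id].
Qed.

Lemma image_affine A (b w : R) : 0 < w ->
  (fun z => b - w * z) @` A = (fun y : R => (b - y) / w) @^-1` A.
Proof.
move=> w0; have w_neq0 : w != 0 by rewrite gt_eqF.
apply/seteqP; split => [_ [z Az <-]|y Ay] /=.
  by rewrite opprB addrC subrK mulrC mulKf.
by exists ((b - y) / w) => //; field.
Qed.

Lemma measurable_image_affine A (b w : R) : 0 < w -> measurable A ->
  measurable ((fun z => b - w * z) @` A).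
Proof.
move=> w0 mA; rewrite image_affine// -[X in measurable X]setTI.
exact: measurable_affine.
Qed.

(** By uniqueness of Lebesgue measure, it is enough to test the rescaled pushforward on half-open
    intervals. *)
Lemma lebesgue_measure_image_affine A (b w : R) : 0 < w -> measurable A ->
  lebesgue_measure ((fun z => b - w * z) @` A) = (w%:E * lebesgue_measure A)%E.
Proof.
move=> w0 mA; have w_neq0 : w != 0 by rewrite gt_eqF.
pose g : measurableTypeR R -> measurableTypeR R := fun y : R => (b - y) / w.
have mg : measurable_fun [set: measurableTypeR R] g := measurable_affine b w.
have wi0 : 0 <= w^-1 by rewrite invr_ge0 ltW.
have -> : lebesgue_measure A = ((w^-1)%:E * pushforward lebesgue_measure g A)%E.
  apply: (@lebesgue_measure_unique R
    (mscale (NngNum wi0) (pushforward lebesgue_measure g))) => // _ [[c d]] _ <-.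
  change (lebesgue_measure `]c, d] = (w^-1)%:E * lebesgue_measure (g @^-1` `]c, d]))%E.
  have -> : g @^-1` `]c, d] = `[b - w * d, b - w * c[%classic.
    apply/seteqP; split => y; rewrite /= !in_itv /= /g ltr_pdivlMr// ler_pdivrMr//; lra.
  rewrite !lebesgue_measure_itv/= !lte_fin ltrD2l ltrN2 ltr_pM2l//.
  case: ifPn => _; last by rewrite mule0.
  by rewrite -EFinM; congr (_%:E); field.
by rewrite /pushforward -image_affine// muleA -EFinM divff// mul1e.
Qed.

Lemma lebesgue_measure_eq_mod_countable A B N : countable N ->
  A `\` N = B `\` N -> measurable A ->
  measurable B /\ lebesgue_measure B = lebesgue_measure A.
Proof.
move=> cN AB mA.
have cC (C : set R) : C `<=` N -> countable C.
  by move=> CN; apply: sub_countable cN; exact: subset_card_le.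
have mc (C : set R) : C `<=` N -> measurable C.
  by move=> /cC; exact: countable_measurable.
have n0 (C : set R) : C `<=` N -> lebesgue_measure C = 0%E.
  by move=> /cC; exact: countable_lebesgue_measure0.
have mAN : measurable (A `\` N) by apply: measurableD => //; exact: mc.
have decomp (C : set R) : C = (C `\` N) `|` (C `&` N).
  by rewrite setDE -setIUr setUC setUv setIT.
have mB : measurable B.
  rewrite (decomp B) -AB; apply: measurableU => //; apply: mc; exact: subIsetr.
by split=> //; rewrite (decomp B) (decomp A) -AB !measureU0//;
  [apply: mc|apply: n0|apply: mc|apply: n0]; exact: subIsetr.
Qed.
End LebesgueComplements.

(** * Gauss branches and the recursion over the first digit *)

Definition cons_seq (a : nat) (u : nat -> nat) : nat -> nat :=
  fun n => if n is k.+1 then u k else a.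

Definition shift_seq (n : nat) (u : nat -> nat) : nat -> nat :=
  fun k => u (n + k)%N.

(** A combinatorial substitute for measurability with respect to the first [n] digits, suited to
    induction on [n]. *)
Definition depends_on_first (n : nat) (S : set (nat -> nat)) :=
  forall u v, (forall i, (i < n)%N -> u i = v i) -> S u -> S v.

Lemma depends_on_first_cons n a S : depends_on_first n.+1 S ->
  depends_on_first n [set u | S (cons_seq a u)].
Proof. by move=> dS u v uv; apply: dS => -[|i]// /uv. Qed.

Lemma depends_on_first_le n n' S : (n <= n')%N ->
  depends_on_first n S -> depends_on_first n' S.
Proof. by move=> nn' dS u v uv; apply: dS => i /leq_trans/(_ nn')/uv. Qed.

Section GaussBranches.
Context {R : realType}.
Implicit Types (x y z g : R) (k n : nat) (S : set (nat -> nat)).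

(** Indexed from 0: [digits x n] is [partial_quotient n.+1 x]. *)
Definition digits x : nat -> nat :=
  fun n => Num.truncn (iter n (@gauss_map R) x)^-1.

Lemma digits_cons k x : 0 <= x < 1 ->
  digits (k.+1%:R + x)^-1 = cons_seq k.+1 (digits x).
Proof.
move=> /andP[x0 x1]; apply/funext => -[|n]; rewrite /digits /cons_seq.
  rewrite /= invrK; apply: truncn_def.
  by rewrite lerDl x0 /= -[in ltRHS]natr1 ltrD2l.
rewrite iterSr; congr (Num.truncn (iter n _ _)^-1).
rewrite /gauss_map invrK (@floor_def _ _ k.+1); first by rewrite addrC addKr.
by rewrite intrD -pmulrn lerDl x0 ltrD2l.
Qed.

(* Carries the uniform law on [0, 1] to the law of density (1 + g) / (1 + g x)^2;
   in the uniform coordinates the inverse branches of the Gauss map are affine. *)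
Definition moebius g y : R := y / (1 + g - g * y).

(** [moebius g] sends this point to 1 / (k + 1); hence in (0, 1] the first digit is k + 1 exactly
    between [branch_end g k.+1] (excluded) and [branch_end g k] (included). *)
Definition branch_end g k : R := (1 + g) / (k.+1%:R + g).

Definition branch_length g k : R := branch_end g k - branch_end g k.+1.

Definition next_param g k : R := (k.+1%:R + g)^-1.

Lemma next_param_itv g k : 0 <= g <= 1 -> 0 <= next_param g k <= 1.
Proof.
move=> /andP[g0 g1]; have k0 : 0 <= k%:R :> R by [].
rewrite /next_param invr_ge0 -natr1; apply/andP; split; first lra.
by rewrite invf_le1; lra.
Qed.

Lemma moebius_itv g z : 0 <= g <= 1 -> 0 <= z < 1 -> 0 <= moebius g z < 1.
Proof.
move=> /andP[g0 g1] /andP[z0 z1]; have d0 : 0 < 1 + g - g * z by nra.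
by rewrite /moebius divr_ge0// ?(ltW d0)//= ltr_pdivrMr//; nra.
Qed.

Lemma natrSD_gt0 g k : 0 <= g -> 0 < k.+1%:R + g.
Proof. by move=> g0; rewrite ltr_wpDr// ltr0Sn. Qed.

Lemma branch_lengthE g k : 0 <= g ->
  branch_length g k = (1 + g) / ((k.+1%:R + g) * (k.+2%:R + g)).
Proof.
move=> g0; have k0 : 0 <= k%:R :> R by [].
rewrite /branch_length /branch_end -2!natr1.
by field; apply/andP; split; lra.
Qed.

Lemma branch_length_gt0 g k : 0 <= g -> 0 < branch_length g k.
Proof.
move=> g0; rewrite branch_lengthE// divr_gt0 ?mulr_gt0 ?natrSD_gt0//; lra.
Qed.

(** This conjugacy makes conditioning on the first digit an affine rescaling: after digit k + 1 the
    tail follows a law of the same family. *)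
Lemma moebius_branch g k z : 0 <= g <= 1 -> 0 <= z < 1 ->
  moebius g (branch_end g k - branch_length g k * z) =
  (k.+1%:R + moebius (next_param g k) z)^-1.
Proof.
move=> /andP[g0 g1] /andP[z0 z1]; have k0 : 0 <= k%:R :> R by [].
rewrite branch_lengthE// /moebius /branch_end /next_param -2!natr1.
have zA : 0 < k%:R + 1 + g + 1 - z by lra.
have gz : 0 <= g * z by rewrite mulr_ge0.
have AA : 0 < (k%:R + 1) * (1 + k%:R + 1 + g) by rewrite mulr_gt0//; lra.
field; apply/and5P; split; rewrite gt_eqF//; try lra.
have -> : (1 + g) * ((1 + k%:R + 1 + g) * (k%:R + 1 + g)) -
    g * ((1 + g) * (1 + k%:R + 1 + g) - (1 + g) * z) =
  (1 + g) * ((k%:R + 1) * (1 + k%:R + 1 + g) + g * z) by ring.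
by apply: mulr_gt0; lra.
Qed.

Lemma branch_end_le g : 0 <= g -> {homo branch_end g : i j / (i <= j)%N >-> j <= i}.
Proof.
move=> g0 i j ij; rewrite /branch_end ler_pM2l; last lra.
by rewrite lef_pV2 ?posrE ?natrSD_gt0// lerD2r ler_nat.
Qed.

(** The interval is (0, 1] because the branches are decreasing: their images of [0, 1) are open on
    the left and tile (0, 1] exactly. *)
Definition digit_event g S : set R :=
  [set y | 0 < y <= 1 /\ S (digits (moebius g y))].

Definition gauss_prob g S : \bar R := lebesgue_measure (digit_event g S).

Lemma digit_event_bigcup g S : 0 <= g <= 1 ->
  digit_event g S = \bigcup_k ((fun z => branch_end g k - branch_length g k * z) @`
    [set z : R | 0 <= z < 1 /\
      S (cons_seq k.+1 (digits (moebius (next_param g k) z)))]).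
Proof.
move=> g01; have /andP[g0 g1] := g01.
apply/seteqP; split => [y [/andP[y0 y1] Sy]|y [k _ [z [z01 Sz] <-]]]; last first.
  split; last by rewrite moebius_branch// digits_cons// moebius_itv// next_param_itv.
  have k0 : 0 < branch_end g k.+1 by apply: divr_gt0; [lra|exact: natrSD_gt0].
  have w0 := branch_length_gt0 k g0; move: z01 => /andP[z0 z1].
  have k1 : branch_end g k <= 1.
    by rewrite (le_trans (branch_end_le g0 (leq0n k)))// /branch_end divff// gt_eqF//; lra.
  have wz : 0 <= branch_length g k * z by rewrite mulr_ge0// ltW.
  have wz1 : branch_length g k * z < branch_length g k by rewrite gtr_pMr.
  by apply/andP; split; move: wz1; rewrite {2}/branch_length; lra.
(* [v] is the reciprocal of [moebius g y], so its integer part is the first digit. *)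
pose v := (1 + g) / y - g.
have v1 : 1 <= v by rewrite /v lerBrDr ler_pdivlMr//; nra.
have /andP[] := @truncn_itv _ v (le_trans ler01 v1).
have : (0 < Num.truncn v)%N by rewrite truncn_gt0.
case: (Num.truncn v) => // k _ kv vk.
exists k => //; have w0 := branch_length_gt0 k g0.
pose z := (branch_end g k - y) / branch_length g k.
have yE : branch_end g k - branch_length g k * z = y.
  by rewrite /z mulrC divfK ?gt_eqF// opprB addrC subrK.
have z01 : 0 <= z < 1.
  rewrite /z divr_ge0 ?(ltW w0)//=; last first.
    rewrite subr_ge0 /branch_end ler_pdivlMr ?natrSD_gt0//.
    by move: kv; rewrite /v lerBrDr ler_pdivlMr// mulrC.
  rewrite ltr_pdivrMr// mul1r /branch_length ltrD2l ltrN2 /branch_end.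
  rewrite ltr_pdivrMr ?natrSD_gt0//.
  by move: vk; rewrite /v ltrBlDr ltr_pdivrMr// mulrC.
exists z => //; split => //.
by move: Sy; rewrite -{1}yE moebius_branch// digits_cons// moebius_itv// next_param_itv.
Qed.

Lemma trivIset_branches g (F : nat -> set R) : 0 <= g ->
  (forall k, F k `<=` [set z : R | 0 <= z < 1]) ->
  trivIset setT (fun k => (fun z => branch_end g k - branch_length g k * z) @` F k).
Proof.
move=> g0 F01; apply/trivIsetP => i j _ _.
wlog ij : i j / (i < j)%N.
  move=> H; rewrite neq_ltn => /orP[ij|ji]; first by apply: H => //; rewrite ltn_eqF.
  by rewrite setIC; apply: H => //; rewrite ltn_eqF.
move=> _; apply/seteqP; split => // y [[z /F01/andP[z0 z1] <-] [z' /F01/andP[z'0 z'1] E]].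
have wi := branch_length_gt0 i g0; have wj := branch_length_gt0 j g0.
have := branch_end_le g0 ij.
have : branch_length g i * z < branch_length g i by rewrite gtr_pMr.
have : 0 <= branch_length g j * z' by rewrite mulr_ge0// ltW.
have : branch_length g i = branch_end g i - branch_end g i.+1 by [].
by move: E => /=; lra.
Qed.

(** Branches take arguments in [0, 1) whereas events live on (0, 1]; only the points 0 and 1 are
    affected. *)
Lemma gauss_prob_co g S : measurable (digit_event g S) ->
  let E := [set z : R | 0 <= z < 1 /\ S (digits (moebius g z))] in
  measurable E /\ lebesgue_measure E = gauss_prob g S.
Proof.
move=> mS E; apply: (@lebesgue_measure_eq_mod_countable _ _ _ [set 0; 1]) => //.
  exact: finite_set_countable.
apply/seteqP; split => z [[/andP[z0 z1] Sz] /= N]; split => //; split => //.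
- by rewrite (ltW z0) lt_neqAle z1 andbT; apply/eqP => z1'; apply: N; right.
- by rewrite (ltW z1) lt_neqAle z0 !andbT; apply/eqP => z1'; apply: N; left.
Qed.

Lemma measurable_digit_event n g S : 0 <= g <= 1 -> depends_on_first n S ->
  measurable (digit_event g S).
Proof.
elim: n g S => [|n IHn] g S g01 dS.
  (* An event that depends on no digit is decided by a single sequence, hence is sure or
     impossible. *)
  have [SS|NS] := pselect (S (fun=> 0%N)).
    rewrite (_ : digit_event g S = `]0, 1]%classic) //.
    apply/seteqP; split => y; rewrite /= in_itv /=; first by case.
    by split=> //; apply: dS SS.
  rewrite (_ : digit_event g S = set0) //.
  by apply/seteqP; split => // y [_ Sy]; apply: NS; apply: dS Sy.
rewrite digit_event_bigcup//; apply: bigcupT_measurable => k.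
apply: measurable_image_affine; first by apply: branch_length_gt0; case/andP: g01.
have /gauss_prob_co[] // := IHn _ _ (next_param_itv k g01)
  (@depends_on_first_cons _ k.+1 _ dS).
Qed.

(** Conditioning on the first digit: the branches are disjoint and cover (0, 1], and each scales
    Lebesgue measure by its length. *)
Lemma gauss_prob_rec n g S : 0 <= g <= 1 -> depends_on_first n S ->
  gauss_prob g S = (\sum_(k <oo) (branch_length g k)%:E *
    gauss_prob (next_param g k) [set u | S (cons_seq k.+1 u)])%E.
Proof.
move=> g01 dS; have g0 : 0 <= g by case/andP: g01.
have mS k : measurable (digit_event (next_param g k) [set u | S (cons_seq k.+1 u)]).
  apply: (@measurable_digit_event n); first exact: next_param_itv.
  by apply: depends_on_first_cons; apply: (depends_on_first_le _ dS).
rewrite {1}/gauss_prob digit_event_bigcup// measure_bigcup//=.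
- rewrite (eq_eseriesl (Q := xpredT)); last by move=> k; rewrite in_setT.
  apply: eq_eseriesr => k _.
  rewrite lebesgue_measure_image_affine ?branch_length_gt0//.
    by rewrite (gauss_prob_co (mS k)).2.
  exact: (gauss_prob_co (mS k)).1.
- move=> k _; apply: measurable_image_affine; first exact: branch_length_gt0.
  exact: (gauss_prob_co (mS k)).1.
- by apply: trivIset_branches => // k z [].
Qed.
End GaussBranches.

(** * Probabilities of digit events, uniformly in the parameter *)

Lemma depends_on_first_shift n d S : depends_on_first d S ->
  depends_on_first (n + d) [set u | S (shift_seq n u)].
Proof.
by move=> dS u v uv; apply: dS => i id; rewrite /shift_seq uv// ltn_add2l.
Qed.

Lemma depends_on_firstI d (S S' : set (nat -> nat)) : depends_on_first d S ->
  depends_on_first d S' -> depends_on_first d (S `&` S').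
Proof. by move=> dS dS' u v uv [Su S'u]; split; [exact: dS Su|exact: dS' S'u]. Qed.

Lemma depends_on_firstC d (S : set (nat -> nat)) : depends_on_first d S ->
  depends_on_first d (~` S).
Proof. by move=> dS u v uv NS Sv; apply: NS; apply: dS Sv => i /uv. Qed.

Section GaussProb.
Context {R : realType}.
Implicit Types (g : R) (S : set (nat -> nat)).

Lemma gauss_prob_ge0 g S : (0 <= gauss_prob g S)%E.
Proof. exact: measure_ge0. Qed.

Lemma le_gauss_prob d d' g S S' : 0 <= g <= 1 -> depends_on_first d S ->
  depends_on_first d' S' -> S `<=` S' -> (gauss_prob g S <= gauss_prob g S')%E.
Proof.
move=> g01 dS dS' SS'; apply: le_measure; rewrite ?inE.
- exact: measurable_digit_event dS.
- exact: measurable_digit_event dS'.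
- by move=> y [y01 /SS'].
Qed.

Lemma gauss_probT g : gauss_prob g setT = 1%E.
Proof.
rewrite /gauss_prob (_ : digit_event g setT = `]0, 1]%classic); last first.
  by apply/seteqP; split => y; rewrite /= in_itv /= => // -[].
by rewrite lebesgue_measure_itv /= lte_fin ltr01 oppr0 adde0.
Qed.

Lemma gauss_prob0 g : gauss_prob g set0 = 0%E.
Proof.
rewrite /gauss_prob (_ : digit_event g set0 = set0) ?measure0//.
by apply/seteqP; split => // y [].
Qed.

Lemma gauss_prob_le1 d g S : 0 <= g <= 1 -> depends_on_first d S ->
  (gauss_prob g S <= 1)%E.
Proof.
by move=> g01 dS; rewrite -(gauss_probT g); apply: (le_gauss_prob (d' := d)) dS _ _.
Qed.

Lemma gauss_probC d g S : 0 <= g <= 1 -> depends_on_first d S ->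
  gauss_prob g (~` S) = (1 - gauss_prob g S)%E.
Proof.
move=> g01 dS; rewrite -(gauss_probT g).
have -> : gauss_prob g setT = (gauss_prob g (~` S) + gauss_prob g S)%E.
  rewrite /gauss_prob -measureU.
  - congr lebesgue_measure; apply/seteqP; split => y.
      by move=> [y01 _]; have [Sy|NSy] := pselect (S (digits (moebius g y))); [right|left].
    by move=> [] [y01 _].
  - exact: (measurable_digit_event g01 (depends_on_firstC dS)).
  - exact: (measurable_digit_event g01 dS).
  - by apply/seteqP; split => // y [[_ NS] [_ /NS]].
rewrite addeK// ge0_fin_numE ?gauss_prob_ge0//.
by rewrite (le_lt_trans (gauss_prob_le1 g01 dS))// ltry.
Qed.

(** The recursion over the first digit, applied to the sure event. *)
Lemma sum_branch_length g : 0 <= g <= 1 ->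
  (\sum_(k <oo) (branch_length g k)%:E = 1)%E.
Proof.
move=> g01; rewrite -(gauss_probT g) (@gauss_prob_rec _ 0)//.
by apply: eq_eseriesr => k _; rewrite gauss_probT mule1.
Qed.

Lemma gauss_prob_rec_ge0 g S k : 0 <= g <= 1 ->
  (0 <= (branch_length g k)%:E * gauss_prob (next_param g k) S)%E.
Proof.
by case/andP=> g0 _; rewrite mule_ge0 ?gauss_prob_ge0// lee_fin ltW ?branch_length_gt0.
Qed.

(** A one-sided Markov property: whatever the first [n] digits, the tail has a parameter in [0, 1],
    so a bound uniform in the parameter factors out. The induction peels off one digit of [C] at a
    time. *)
Lemma gauss_prob_indep n d (C F : set (nat -> nat)) (K : R) g :
    0 <= g <= 1 -> depends_on_first n C -> depends_on_first d F ->
    (forall g', 0 <= g' <= 1 -> (gauss_prob g' F <= K%:E)%E) ->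
  (gauss_prob g (C `&` [set u | F (shift_seq n u)]) <= K%:E * gauss_prob g C)%E.
Proof.
move=> g01 dC dF FK; have K0 : (0 <= K)%R.
  by rewrite -lee_fin (le_trans (gauss_prob_ge0 g F))// FK.
elim: n C g g01 dC => [|n IHn] C g g01 dC.
  have [C0|NC0] := pselect (C (fun=> 0%N)).
    have -> : C = setT by apply/seteqP; split => // u _; apply: dC C0.
    by rewrite setTI gauss_probT mule1; exact: FK.
  have -> : C = set0 by apply/seteqP; split => // u Cu; apply: NC0; apply: dC Cu.
  by rewrite set0I gauss_prob0 mule0.
have dCF : depends_on_first (n.+1 + d) (C `&` [set u | F (shift_seq n.+1 u)]).
  apply: depends_on_firstI; last exact: depends_on_first_shift.
  by apply: depends_on_first_le dC; rewrite leq_addr.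
rewrite (gauss_prob_rec g01 dCF) (@gauss_prob_rec _ n.+1 g C)// -nneseriesZl; last first.
  by move=> k _; exact: gauss_prob_rec_ge0.
apply: lee_nneseries => [k _ _|k _]; first exact: gauss_prob_rec_ge0.
rewrite muleCA; apply: lee_wpmul2l.
  by rewrite lee_fin ltW// branch_length_gt0//; case/andP: g01.
apply: (IHn [set u | C (cons_seq k.+1 u)]); first exact: next_param_itv.
exact: depends_on_first_cons.
Qed.

Lemma gauss_prob_shift_le n d S (K : R) g : 0 <= g <= 1 ->
    depends_on_first d S ->
    (forall g', 0 <= g' <= 1 -> (gauss_prob g' S <= K%:E)%E) ->
  (gauss_prob g [set u | S (shift_seq n u)] <= K%:E)%E.
Proof.
move=> g01 dS SK; have := @gauss_prob_indep n d setT S K g g01.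
by rewrite setTI gauss_probT mule1; exact.
Qed.

(** The probability of first digit k + 1 under the uniform law, that is [branch_length 0 k]. *)
Definition digit_weight k : R := (k.+1%:R * k.+2%:R)^-1.

Lemma digit_weight_gt0 k : 0 < digit_weight k.
Proof. by rewrite invr_gt0 mulr_gt0. Qed.

Lemma digit_weightM_ge0 k (a : \bar R) : (0 <= a -> 0 <= (digit_weight k)%:E * a)%E.
Proof. by move=> a0; rewrite mule_ge0// lee_fin ltW// digit_weight_gt0. Qed.

Lemma digit_weightE k : digit_weight k = k.+1%:R^-1 - k.+2%:R^-1.
Proof.
have k0 : 0 <= k%:R :> R by [].
rewrite /digit_weight -2!natr1; field; by apply/andP; split; lra.
Qed.

Lemma branch_length_le g k : 0 <= g <= 1 -> branch_length g k <= 2 * digit_weight k.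
Proof.
move=> /andP[g0 g1]; rewrite branch_lengthE// /digit_weight.
apply: ler_pM; [lra| |lra|]; first by rewrite invr_ge0 mulr_ge0// ltW ?natrSD_gt0.
by rewrite lef_pV2 ?posrE ?mulr_gt0 ?natrSD_gt0// ler_pM// lerDl.
Qed.

Lemma branch_length_ge g k : 0 <= g <= 1 -> digit_weight k / 2 <= branch_length g k.
Proof.
move=> /andP[g0 g1]; rewrite branch_lengthE// /digit_weight.
have k0 : 0 <= k%:R :> R by [].
rewrite ler_pdivlMr ?mulr_gt0 ?natrSD_gt0// -invfM ler_pdivrMl ?mulr_gt0//.
rewrite -2!natr1; have kg : 0 <= k%:R * g by rewrite mulr_ge0.
have kkg : 0 <= k%:R * k%:R * g by rewrite !mulr_ge0.
have kk : 0 <= k%:R * k%:R :> R by rewrite mulr_ge0.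
have : g * g <= 1 by nra.
nra.
Qed.

End GaussProb.

(** * Elementary sums *)

Section RealSums.
Context {R : realType}.
Implicit Types (x X a : R).

Lemma ln_succ_ge a : 0 < a -> (a + 1)^-1 <= ln (a + 1) - ln a.
Proof.
move=> a0; have a1 : 0 < a + 1 by lra.
have t1 : (a + 1)^-1 < 1 by rewrite invf_lt1//; lra.
have /le_ln1Dx : -1 < - (a + 1)^-1 by lra.
have -> : 1 - (a + 1)^-1 = a / (a + 1) by field; lra.
by rewrite ln_div ?posrE//; lra.
Qed.

Lemma ln_succ_le a : 0 < a -> ln (a + 1) - ln a <= a^-1.
Proof.
move=> a0; have ai : 0 < a^-1 by rewrite invr_gt0.
have /le_ln1Dx : -1 < a^-1 by lra.
have -> : 1 + a^-1 = (a + 1) / a by field; lra.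
by rewrite ln_div ?posrE//; lra.
Qed.

Lemma ln_le_sum_inv n : ln n.+1%:R <= \sum_(k < n) (k.+1%:R)^-1 :> R.
Proof.
elim: n => [|n IHn]; first by rewrite big_ord0 ln1.
rewrite big_ord_recr /=; have := @ln_succ_le n.+1%:R.
rewrite natr1 ltr0Sn => /(_ isT) h; apply: le_trans (lerD IHn h).
by rewrite addrC subrK.
Qed.

Lemma sum_inv_le_ln X n : 0 < X ->
  \sum_(k < n | k.+1%:R < X) (k.+2%:R)^-1 <= ln (1 + X).
Proof.
(* Truncating at the minimum of [n] and [X] gives a bound that grows with [n] only while terms are
   added, so the induction closes. *)
move=> X0; apply: (@le_trans _ _ (ln (1 + Num.min n%:R X))); last first.
  rewrite ler_ln ?posrE ?lerD2l ?ge_min ?lexx ?orbT//; last lra.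
  by rewrite ltr_pwDl// le_min ler0n ltW.
elim: n => [|n IHn]; first by rewrite big_ord0 ln_ge0// lerDl le_min lexx ltW.
have mono : ln (1 + Num.min n%:R X) <= ln (1 + Num.min n.+1%:R X).
  have mp i : 0 < 1 + Num.min i%:R X by rewrite ltr_pwDl// le_min ler0n ltW.
  rewrite ler_ln ?posrE// lerD2l.
  by rewrite le_min !ge_min lexx orbT andbT ler_nat leqnSn.
rewrite big_mkcond big_ord_recr -big_mkcond /=; case: ifPn => [nX|_]; last first.
  by rewrite addr0 (le_trans IHn).
have mE : Num.min n.+1%:R X = n.+1%:R by apply/min_idPl; rewrite ltW.
have mE' : Num.min n%:R X = n%:R.
  by apply/min_idPl; rewrite (le_trans _ (ltW nX))// ler_nat.
move: IHn; rewrite mE mE' ![1 + _]addrC !natr1.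
have := @ln_succ_ge n.+1%:R; rewrite natr1 ltr0Sn => /(_ isT) h /lerD/(_ h).
by rewrite addrCA subrr addr0.
Qed.

Lemma sum_digit_weight_tail X n : 0 < X ->
  \sum_(k < n | X <= k.+1%:R) digit_weight k <= X^-1.
Proof.
(* The sum telescopes from its first index with k + 1 >= X; the maximum with 0 covers the [n] before
   that index. *)
move=> X0; apply: (@le_trans _ _ (Num.max 0 (X^-1 - n.+1%:R^-1))); last first.
  by rewrite ge_max invr_ge0 ltW//= gerBl.
elim: n => [|n IHn]; first by rewrite big_ord0 le_max lexx.
have mono : n.+2%:R^-1 <= n.+1%:R^-1 :> R by rewrite lef_pV2 ?posrE// ler_nat.
rewrite big_mkcond big_ord_recr -big_mkcond /=; case: ifPn => [nX|_]; last first.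
  by rewrite addr0 (le_trans IHn)// ge_max !le_max lexx /= lerD2l lerN2 mono orbT.
have Xn : n.+1%:R^-1 <= X^-1 by rewrite lef_pV2 ?posrE.
have mE : Num.max 0 (X^-1 - n.+1%:R^-1) = X^-1 - n.+1%:R^-1.
  by apply/max_idPr; rewrite subr_ge0.
move: IHn; rewrite mE digit_weightE le_max => h; apply/orP; right.
by apply: le_trans (lerD h (lexx _)) _; rewrite addrA subrK.
Qed.

(* The terms are at most those of a telescoping sum of powers of exponent
   [x - 1 < 0]. *)
Lemma sum_digit_weight_powR x n : 0 <= x < 1 ->
  \sum_(k < n) digit_weight k * k.+1%:R `^ x <= 2 / (1 - x).
Proof.
move=> /andP[x0 x1]; set e := 1 - x; have e0 : 0 < e by rewrite /e; lra.
have e1 : e <= 1 by rewrite /e; lra.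
have step k : digit_weight k * k.+1%:R `^ x <=
    2 / e * (k.+1%:R `^ (- e) - k.+2%:R `^ (- e)).
  set a : R := k.+1%:R; have a0 : 0 < a by rewrite ltr0Sn.
  have -> : k.+2%:R = a + 1 :> R by rewrite /a natr1.
  have -> : a `^ x = a * a `^ (- e).
    rewrite (_ : a `^ x = a `^ (1 + - e)); last by congr powR; rewrite /e; ring.
    by rewrite powRD ?powRr1 ?(ltW a0)// (gt_eqF a0) implybT.
  have -> : digit_weight k = a^-1 * (a + 1)^-1.
    by rewrite /digit_weight /a natr1 invfM.
  set t := (a + 1)^-1; have t0 : 0 < t by rewrite invr_gt0; lra.
  have t1 : t <= 1 by rewrite invf_le1; lra.
  set P := a `^ (- e); have P0 : 0 <= P by exact: powR_ge0.
  (* The ratio of the two powers is exp(- e (ln (a + 1) - ln a)), bounded through exp u >= 1 + u. *)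
  have PE : (a + 1) `^ (- e) <= P * (1 + e * t)^-1.
    rewrite /P /powR !gt_eqF//; last lra.
    have -> : - e * ln (a + 1) = - e * ln a + - (e * (ln (a + 1) - ln a)) by ring.
    rewrite expRD ler_pM2l ?expR_gt0// expRN lef_pV2 ?posrE ?expR_gt0//; last nra.
    apply: le_trans (expR_ge1Dx _); rewrite lerD2l ler_pM2l//.
    exact: ln_succ_ge.
  have et : 0 < e * t by rewrite mulr_gt0.
  (* Since e t <= 1, the denominator 1 + e t is at most 2; this is the factor 2 of the final
     bound. *)
  have key : e * t / 2 <= 1 - (1 + e * t)^-1.
    have -> : 1 - (1 + e * t)^-1 = e * t / (1 + e * t) by field; lra.
    rewrite ler_pM2l// lef_pV2 ?posrE; nra.
  have -> : a^-1 * t * (a * P) = t * P by field; lra.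
  apply: (@le_trans _ _ (2 / e * (P * (e * t / 2)))).
    by rewrite le_eqVlt; apply/orP; left; apply/eqP; field; lra.
  rewrite ler_pM2l ?divr_gt0//; have := ler_wpM2l P0 key; lra.
apply: (@le_trans _ _
  (\sum_(k < n) 2 / e * (k.+1%:R `^ (- e) - k.+2%:R `^ (- e)))).
  by apply: ler_sum => k _; exact: step.
rewrite -mulr_sumr -(big_mkord xpredT (fun k => k.+1%:R `^ (- e) - k.+2%:R `^ (- e))).
rewrite (eq_bigr (fun k => - (k.+2%:R `^ (- e)) - - (k.+1%:R `^ (- e)))); last first.
  by move=> k _; rewrite opprK addrC.
rewrite (@telescope_sumr _ _ _ (fun k => - (k.+1%:R `^ (- e))))//.
rewrite powR1 ger_pMr ?divr_gt0//; have := powR_ge0 n.+1%:R (- e); lra.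
Qed.
End RealSums.

(** * The law of a weighted product of digits *)

Section TailBounds.
Context {R : realType}.
Implicit Types (g x X : R) (s : seq R) (f : R -> \bar R).

(** Recursive on a list of exponents, so that removing the first exponent matches removing the first
    digit. *)
Fixpoint weighted_prod s (u : nat -> nat) : R :=
  if s is x :: s' then (u 0)%:R `^ x * weighted_prod s' (shift_seq 1 u) else 1.

Definition prod_event s X : set (nat -> nat) := [set u | X <= weighted_prod s u].

Lemma depends_on_first_prod_event s X :
  depends_on_first (size s) (prod_event s X).
Proof.
move=> u v uv; rewrite /prod_event /=; suff -> : weighted_prod s u = weighted_prod s v by [].
elim: s u v uv => //= x s IHs u v uv; rewrite uv//; congr (_ * _).
by apply: IHs => i si; rewrite /shift_seq uv.
Qed.

Lemma prod_event_cons x s X k :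
  [set u | prod_event (x :: s) X (cons_seq k.+1 u)] =
  prod_event s (X / k.+1%:R `^ x).
Proof.
apply/seteqP; split => u; rewrite /prod_event /= ler_pdivrMr ?powR_gt0// mulrC//.
Qed.

Lemma gauss_prob_prod_cons g x s X : 0 <= g <= 1 ->
  gauss_prob g (prod_event (x :: s) X) =
  (\sum_(k <oo) (branch_length g k)%:E *
     gauss_prob (next_param g k) (prod_event s (X / k.+1%:R `^ x)))%E.
Proof.
move=> g01; rewrite (gauss_prob_rec g01 (depends_on_first_prod_event (s := x :: s) (X := X))).
by apply: eq_eseriesr => k _; rewrite prod_event_cons.
Qed.

Lemma natS_powR_ge1 x k : 0 <= x -> 1 <= k.+1%:R `^ x.
Proof. by move=> x0; rewrite -[leLHS](powRr0 k.+1%:R) ler_powR// ler1n. Qed.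

(** Up to a factor 2, this operator majorizes one step of the recursion for every parameter [g]. *)
Definition digit_mean x f X : \bar R :=
  (\sum_(k <oo) (digit_weight k)%:E * f (X / k.+1%:R `^ x)%R)%E.

Lemma nneseries_le (u : nat -> \bar R) (B : \bar R) : (forall k, 0 <= u k)%E ->
  (forall n, \sum_(k < n) u k <= B)%E -> (\sum_(k <oo) u k <= B)%E.
Proof.
move=> u0 uB; apply: lime_le; first exact: is_cvg_nneseries.
by apply: nearW => n; rewrite /= big_mkord; exact: uB.
Qed.

Lemma digit_mean_le (F : nat -> \bar R) (G : nat -> R) (B : R) :
  (forall k, 0 <= F k)%E -> (forall k, F k <= (G k)%:E)%E ->
  (forall n, \sum_(k < n) digit_weight k * G k <= B) ->
  (\sum_(k <oo) (digit_weight k)%:E * F k <= B%:E)%E.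
Proof.
move=> F0 FG GB; apply: nneseries_le => [k|n].
  exact: digit_weightM_ge0.
apply: (@le_trans _ _ (\sum_(k < n) (digit_weight k * G k)%:E)%E).
  apply: lee_sum => k _; rewrite EFinM lee_wpmul2l// lee_fin ltW//.
  exact: digit_weight_gt0.
by rewrite sumEFin lee_fin.
Qed.

Lemma digit_mean_ge0 x f X : (forall Y, 0 <= f Y)%E -> (0 <= digit_mean x f X)%E.
Proof.
move=> f0; apply: nneseries_ge0 => k _ _.
exact: digit_weightM_ge0.
Qed.

(** A version of ln X that stays at least 1 for X >= 0, so that constants and lower powers are
    absorbed, also for thresholds below 1. *)
Definition log_growth X : R := 1 + ln (1 + X).

Lemma log_growth_ge1 X : 0 <= X -> 1 <= log_growth X.
Proof. by move=> X0; rewrite /log_growth lerDl ln_ge0// lerDl. Qed.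

Lemma le_log_growth X Y : 0 < X -> X <= Y -> log_growth X <= log_growth Y.
Proof. by move=> X0 XY; rewrite /log_growth lerD2l ler_ln ?posrE; lra. Qed.

(* For [j = 0] (no exponent equal to 1 so far) a pointwise bound by [C / X]
   would cost a spurious logarithm at the first exponent 1, so the bound
   demanded is the one obtained after averaging over that digit. *)
Definition tail_bound (j : nat) f (C : R) : Prop :=
  if j is i.+1 then forall X, 0 < X -> (f X <= (C * log_growth X ^+ i / X)%:E)%E
  else forall X, 0 < X -> (digit_mean 1 f X <= (C / X)%:E)%E.

(** The majorant [f] does not depend on [g], which lets the averages over different digits be
    interchanged. It is kept at most 1 to control the digits that exceed the threshold by
    themselves. *)
Lemma prod_event_dominated s : (forall x, x \in s -> 0 <= x <= 1) ->
  exists f (C : R), [/\ forall X, (0 <= f X <= 1)%E,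
    forall g X, 0 <= g <= 1 -> 0 < X -> (gauss_prob g (prod_event s X) <= f X)%E,
    0 <= C & tail_bound (count_mem 1 s) f C].
Proof.
elim: s => [|x s IHs] s01.
  exists (fun X => if X <= 1 then 1%E else 0%E), 1; split => //.
  - by move=> X; case: ifP; rewrite !lexx lee01.
  - move=> g X g01 X0; case: ifPn => [_|X1].
      by apply: (gauss_prob_le1 g01); exact: depends_on_first_prod_event.
    rewrite (_ : prod_event [::] X = set0) ?gauss_prob0//.
    by apply/seteqP; split => // u; rewrite /prod_event /= (negbTE X1).
  - move=> X X0; rewrite mul1r.
    apply: (@digit_mean_le _ (fun k => if X <= k.+1%:R then 1 else 0)).
    + by move=> k; case: ifP.
    + by move=> k; rewrite powRr1// ler_pdivrMr// mul1r; case: ifP.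
    + move=> n; apply: le_trans (sum_digit_weight_tail n X0).
      rewrite [leRHS]big_mkcond /=; apply: ler_sum => k _.
      by case: ifP; rewrite ?mulr1 ?mulr0.
have /IHs[f [C [f01 sf C0 fC]]] : forall y, y \in s -> 0 <= y <= 1.
  by move=> y ys; apply: s01; rewrite inE ys orbT.
have f0 X : (0 <= f X)%E by case/andP: (f01 X).
have f1 X : (f X <= 1)%E by case/andP: (f01 X).
have /andP[x0 x1] : 0 <= x <= 1 by apply: s01; rewrite mem_head.
(* The factor 2 comes from [branch_length_le]. *)
pose f' X := Order.min 1%E (2%:E * digit_mean x f X)%E.
have f'E X : (f' X <= 2%:E * digit_mean x f X)%E by rewrite ge_min lexx orbT.
have f'0 X : (0 <= f' X)%E by rewrite le_min lee01 mule_ge0// digit_mean_ge0.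
have dom g X : 0 <= g <= 1 -> 0 < X -> (gauss_prob g (prod_event (x :: s) X) <= f' X)%E.
  move=> g01 X0; rewrite le_min; apply/andP; split.
    exact: (gauss_prob_le1 g01 (@depends_on_first_prod_event (x :: s) X)).
  rewrite gauss_prob_prod_cons// /digit_mean -nneseriesZl; last first.
    by move=> k _; rewrite mule_ge0// lee_fin ltW// digit_weight_gt0.
  apply: lee_nneseries => [k _ _|k _]; first exact: gauss_prob_rec_ge0.
  rewrite muleA -EFinM; apply: lee_pmul; rewrite ?gauss_prob_ge0 ?lee_fin ?branch_length_le//.
    by case/andP: g01 => g0 _; rewrite ltW// branch_length_gt0.
  by apply: sf; [exact: next_param_itv|rewrite divr_gt0// powR_gt0].
have scale D X : (digit_mean x f X <= D%:E -> f' X <= (2 * D)%:E)%E.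
  by move=> h; rewrite (le_trans (f'E X))// EFinM lee_wpmul2l.
have [x_eq1|x_neq1] := eqVneq x 1.
  subst x; rewrite /= eqxx; case: (count_mem 1 s) fC => [|j] /= fC.
    (* At the first exponent 1, the averaged bound held in [tail_bound 0] is exactly the pointwise
       bound required. *)
    exists f', (2 * C); split => //; first by move=> X; rewrite f'0 ge_min lexx.
      by rewrite mulr_ge0.
    by move=> X X0; rewrite mulr1 -mulrA; apply/scale/fC.
  exists f', (2 * (C + 1)); split => //; first by move=> X; rewrite f'0 ge_min lexx.
    by rewrite mulr_ge0 ?addr_ge0.
  move=> X X0; rewrite add0n -!mulrA; apply: scale.
  have L1 := log_growth_ge1 (ltW X0); have L0 : 0 <= log_growth X by lra.
  set D := C * log_growth X ^+ j / X.
  have D0 : 0 <= D by rewrite /D divr_ge0 ?mulr_ge0 ?exprn_ge0// ltW.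
  (* Digits below [X] use the induction hypothesis and sum to a further logarithm; digits from [X]
     on use f <= 1 and have total weight at most 1 / X, hence the constant C + 1. *)
  apply: (@digit_mean_le _ (fun k => if k.+1%:R < X then D * k.+1%:R else 1)) => //.
    move=> k; rewrite powRr1//; case: ifPn => // kX.
    apply: le_trans (fC _ _) _; first by rewrite divr_gt0.
    rewrite lee_fin invfM invrK mulrA ler_wpM2r// /D.
    rewrite ler_wpM2r ?invr_ge0 ?(ltW X0)// ler_wpM2l// lerXn2r ?nnegrE//.
      by rewrite (le_trans ler01)// log_growth_ge1// divr_ge0// ltW.
    by apply: le_log_growth; rewrite ?divr_gt0// ler_pdivrMr// ler_peMr ?ler1n// ltW.
  move=> n; rewrite (bigID (fun k : 'I_n => k.+1%:R < X)) /=.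
  rewrite (eq_bigr (fun k : 'I_n => D * k.+2%:R^-1)); last first.
    move=> k kX; rewrite kX /digit_weight invfM.
    by rewrite [D * _]mulrC mulrA [_ * k.+1%:R]mulrAC mulVf// mul1r mulrC.
  rewrite -mulr_sumr [X in _ + X](eq_big (fun k : 'I_n => X <= k.+1%:R)
    (fun k => digit_weight k)); last 2 first.
  - by move=> k; rewrite -leNgt.
  - by move=> k; rewrite -leNgt => /le_gtF ->; rewrite mulr1.
  apply: le_trans (lerD (ler_wpM2l D0 (sum_inv_le_ln n X0)) (sum_digit_weight_tail n X0)) _.
  have LE : ln (1 + X) <= log_growth X by rewrite /log_growth lerDr.
  have Lj : 1 <= log_growth X ^+ j.+1 by rewrite exprn_ege1.
  rewrite mulrDl mul1r; apply: lerD.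
    apply: le_trans (ler_wpM2l D0 LE) _.
    by rewrite /D exprSr -!mulrA [X^-1 * _]mulrC.
  by rewrite ler_peMl// invr_ge0 ltW.
have x01 : 0 <= x < 1 by rewrite x0 lt_neqAle x_neq1.
set B := 2 / (1 - x); have B0 : 0 <= B by rewrite /B divr_ge0//; lra.
(* A digit of exponent x < 1 weakens the bound by (k + 1)^x, whose mean is at most [B]. *)
have mean_le (F : nat -> \bar R) (D : R) : 0 <= D -> (forall k, 0 <= F k)%E ->
    (forall k, F k <= (D * k.+1%:R `^ x)%:E)%E ->
    (\sum_(k <oo) (digit_weight k)%:E * F k <= (B * D)%:E)%E.
  move=> D0 F0 FD; apply: (digit_mean_le F0 FD) => n.
  under eq_bigr do rewrite mulrCA.
  by rewrite -mulr_sumr mulrC ler_wpM2r// sum_digit_weight_powR.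
clearbody B; exists f', (2 * (B * C)); split => //; first by move=> X; rewrite f'0 ge_min lexx.
  by apply: mulr_ge0 => //; exact: mulr_ge0.
rewrite /= (negbTE x_neq1) add0n; case: (count_mem 1 s) fC => [|j] /= fC X X0.
  rewrite /digit_mean.
  have wf0 i k : (0 <= (digit_weight i)%:E *
      ((digit_weight k)%:E * f (X / i.+1%:R `^ 1 / k.+1%:R `^ x)%R))%E.
    by do 2!apply: digit_weightM_ge0.
  (* With no exponent 1 so far the bound to preserve is the average over an extra digit of exponent
     1; exchanging the two sums puts that average directly on [f]. *)
  apply: (@le_trans _ _ (\sum_(i <oo) 2%:E * \sum_(k <oo)
     ((digit_weight i)%:E * ((digit_weight k)%:E * f (X / i.+1%:R `^ 1 / k.+1%:R `^ x)%R)))%E).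
    apply: lee_nneseries => [i _ _|i _]; first exact: digit_weightM_ge0.
    rewrite nneseriesZl; last by move=> k _; rewrite mule_ge0// lee_fin ltW// digit_weight_gt0.
    by rewrite muleCA lee_wpmul2l ?f'E// lee_fin ltW// digit_weight_gt0.
  rewrite nneseriesZl; last by move=> i _; apply: nneseries_ge0.
  rewrite -!mulrA EFinM lee_wpmul2l// nneseries_interchange//.
  apply: (@le_trans _ _ (\sum_(k <oo) (digit_weight k)%:E *
     digit_mean 1 f (X / k.+1%:R `^ x)%R)%E).
    apply: lee_nneseries => [k _ _|k _]; first by apply: nneseries_ge0.
    rewrite -nneseriesZl; last by move=> i _; rewrite mule_ge0// lee_fin ltW// digit_weight_gt0.
    apply: lee_nneseries => [i _ _|i _] //.
    by rewrite muleCA [(X / _ / _)%R]mulrAC.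
  apply: mean_le; first by rewrite divr_ge0// ltW.
    by move=> k; exact: digit_mean_ge0.
  move=> k; apply: le_trans (fC _ _) _; first by rewrite divr_gt0// powR_gt0.
  by rewrite lee_fin invfM invrK mulrA.
rewrite -!mulrA; apply: scale; have L1 := log_growth_ge1 (ltW X0).
have L0 : 0 <= log_growth X by lra.
apply: mean_le => //; first by rewrite mulrA divr_ge0 ?mulr_ge0 ?exprn_ge0// ltW.
move=> k; have k1 : 1 <= k.+1%:R `^ x by exact: natS_powR_ge1.
have k0 : 0 < k.+1%:R `^ x by rewrite powR_gt0.
apply: le_trans (fC _ _) _; first by rewrite divr_gt0.
rewrite lee_fin invfM invrK !mulrA ler_wpM2r ?(ltW k0)//.
rewrite ler_wpM2r ?invr_ge0 ?(ltW X0)// ler_wpM2l// lerXn2r ?nnegrE//.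
  by rewrite (le_trans ler01)// log_growth_ge1// divr_ge0// ltW.
by apply: le_log_growth; rewrite ?divr_gt0// ler_pdivrMr// ler_peMr// ltW.
Qed.
End TailBounds.

(** * Lower bounds for the tail of a weighted product *)

Section LowerBound.
Context {R : realType}.
Implicit Types (g x X : R) (s : seq R).

(** The recursion only meets digits at least 1, so the threshold never rises above 1; points with
    finite expansion have measure zero and need no separate treatment. *)
Lemma gauss_prob_prod_small s g X : (forall x, x \in s -> 0 <= x) ->
  0 <= g <= 1 -> X <= 1 -> gauss_prob g (prod_event s X) = 1%E.
Proof.
elim: s g X => [|x s IHs] g X s0 g01 X1.
  by rewrite (_ : prod_event [::] X = setT) ?gauss_probT//; apply/seteqP; split.
rewrite gauss_prob_prod_cons// -(sum_branch_length g01).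
apply: eq_eseriesr => k _; rewrite IHs ?mule1//.
- by move=> y ys; apply: s0; rewrite inE ys orbT.
- exact: next_param_itv.
- by rewrite ler_pdivrMr ?powR_gt0// mul1r (le_trans X1)// natS_powR_ge1// s0// mem_head.
Qed.

Lemma le_sum_nneseries (F : nat -> \bar R) (G : nat -> R) n :
  (forall k, 0 <= F k)%E -> (forall k, (k < n)%N -> (G k)%:E <= F k)%E ->
  ((\sum_(k < n) G k)%:E <= \sum_(k <oo) F k)%E.
Proof.
move=> F0 GF; apply: le_trans (nneseries_lim_ge n (fun k _ _ => F0 k)).
by rewrite -sumEFin big_mkord; apply: lee_sum => k _; exact: GF.
Qed.

Lemma sum_digit_weight_itv N m :
  \sum_(k < N + m) (if (N <= k)%N then digit_weight k else 0) =
  N.+1%:R^-1 - (N + m).+1%:R^-1 :> R.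
Proof.
elim: m => [|m IHm].
  by rewrite addn0 subrr big1// => k _; rewrite leqNgt ltn_ord.
by rewrite addnS big_ord_recr /= IHm leq_addr digit_weightE addrA subrK.
Qed.

(** Only favourable digits are kept: 1 at an exponent below 1, at most the square root of [X] at an
    exponent 1 followed by another one, and more than [X] at the last exponent 1. The square root
    keeps the remaining logarithm at least half of ln X. *)
Lemma gauss_prob_prod_ge s : (forall x, x \in s -> 0 <= x <= 1) ->
  (0 < count_mem 1%R s)%N ->
  exists2 c : R, 0 < c & forall g X, 0 <= g <= 1 -> 1 <= X ->
    ((c * ln X ^+ (count_mem 1 s).-1 / X)%:E <= gauss_prob g (prod_event s X))%E.
Proof.
elim: s => // x s IHs s01; have s01' y : y \in s -> 0 <= y <= 1.
  by move=> ys; apply: s01; rewrite inE ys orbT.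
have /andP[x0 x1] : 0 <= x <= 1 by apply: s01; rewrite mem_head.
have F0 g X k : 0 <= g <= 1 -> (0 <= (branch_length g k)%:E *
    gauss_prob (next_param g k) (prod_event s (X / k.+1%:R `^ x)%R))%E.
  exact: gauss_prob_rec_ge0.
have [x_eq1|x_neq1] := eqVneq x 1; last first.
  rewrite /= (negbTE x_neq1) add0n => /(IHs s01')[c c0 Hc].
  exists (c / 4); first by rewrite divr_gt0.
  (* Only the term of digit 1 is kept; its probability is at least 1/4, and the threshold is
     unchanged. *)
  move=> g X g01 X1; rewrite gauss_prob_prod_cons//.
  apply: le_trans (nneseries_lim_ge 1 (fun k _ _ => F0 g X k g01)).
  rewrite big_nat1 powR1 divr1.
  apply: (@le_trans _ _ (4^-1%:E * (c * ln X ^+ (count_mem 1 s).-1 / X)%:E)%E).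
    by rewrite -EFinM lee_fin !mulrA [4^-1 * c]mulrC.
  apply: lee_pmul; rewrite ?lee_fin ?invr_ge0//.
  - by rewrite divr_ge0 ?(le_trans ler01 X1)// mulr_ge0 ?exprn_ge0 ?ln_ge0// ltW.
  - apply: le_trans (branch_length_ge 0 g01).
    by rewrite /digit_weight mul1r -invfM lef_pV2 ?posrE// -natrM ler_nat.
  - by apply: Hc => //; exact: next_param_itv.
rewrite /= x_eq1 eqxx => _; rewrite x_eq1 in F0.
have [s_eq0|] := posnP (count_mem 1 s).
  exists (8^-1); first by rewrite invr_gt0.
  move=> g X g01 X1; rewrite gauss_prob_prod_cons// s_eq0 expr0 mulr1.
  have X0 : 0 <= X by rewrite (le_trans ler01).
  pose N := Num.truncn X; have /andP[NX XN] : N%:R <= X < N.+1%:R by exact: truncn_itv.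
  have N0 : (0 < N)%N by rewrite truncn_gt0.
  (* The window N <= k < 2 N + 1 telescopes to 1 / (2 (N + 1)); [branch_length_ge] costs another
     1/2, and N + 1 <= 2 X gives 1/8. *)
  apply: le_trans (@le_sum_nneseries _ (fun k =>
     (if (N <= k)%N then digit_weight k else 0) / 2) (N + N.+1) _ _).
  - rewrite -mulr_suml sum_digit_weight_itv -addSn addnn -muln2 natrM lee_fin.
    rewrite (_ : (N.+1%:R^-1 - (N.+1%:R * 2)^-1) / 2 = 4^-1 * N.+1%:R^-1); last first.
      by field; rewrite gt_eqF// ltr_wpDr.
    rewrite -!invfM lef_pV2 ?posrE ?mulr_gt0// ?(lt_le_trans ltr01 X1)//.
    have N1 : 1 <= N%:R :> R by rewrite ler1n.
    by rewrite -[N.+1%:R]natr1; lra.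
  - by move=> k; exact: F0.
  - move=> k _; case: ifPn => [Nk|_]; last by rewrite mul0r; exact: F0.
    rewrite gauss_prob_prod_small ?mule1 ?lee_fin ?branch_length_ge//.
    + by move=> y /s01'/andP[].
    + exact: next_param_itv.
    + rewrite powRr1// ler_pdivrMr// mul1r ltW// (lt_le_trans XN)// ler_nat.
      by rewrite ltnS.
move=> s_gt0; have [c c0 Hc] := IHs s01' s_gt0.
case: (count_mem 1 s) s_gt0 Hc => // j _ /= Hc.
(* Halving the logarithm gives 2^-j. The 8 collects three factors 2: from [branch_length_ge], from k
   + 2 <= 2 (k + 1), and from summing 1 / (k + 1) only up to the square root of [X]. *)
exists (c * 2^-1 ^+ j / 8); first by rewrite divr_gt0// mulr_gt0// exprn_gt0.
move=> g X g01 X1; rewrite gauss_prob_prod_cons//.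
have X0 : 0 < X by rewrite (lt_le_trans ltr01).
have S1 : 1 <= Num.sqrt X by rewrite -sqrtr1 ler_wsqrtr.
have S0 : 0 <= Num.sqrt X by rewrite sqrtr_ge0.
have SS : Num.sqrt X * Num.sqrt X = X by rewrite -expr2 sqr_sqrtr// ltW.
have lnS : ln (Num.sqrt X) = ln X / 2.
  have := lnM (x := Num.sqrt X) (y := Num.sqrt X); rewrite SS !posrE.
  rewrite !(lt_le_trans ltr01 S1) => /(_ isT isT) ->; lra.
pose N := Num.truncn (Num.sqrt X).
have /andP[NX XN] : N%:R <= Num.sqrt X < N.+1%:R by exact: truncn_itv.
set D := c / (2 * X) * (ln X / 2) ^+ j.
have lnX0 : 0 <= ln X by rewrite ln_ge0.
have D0 : 0 <= D.
  by rewrite /D mulr_ge0 ?exprn_ge0 ?divr_ge0 ?mulr_ge0 ?(ltW c0) ?(ltW X0).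
apply: le_trans (@le_sum_nneseries _ (fun k => D * (2^-1 * k.+1%:R^-1)) N _ _).
- rewrite -!mulr_sumr lee_fin.
  apply: (@le_trans _ _ (D * (2^-1 * (ln X / 2)))).
    rewrite le_eqVlt; apply/orP; left; apply/eqP; rewrite /D exprMn exprS.
    by field; rewrite gt_eqF.
  rewrite ler_wpM2l// ler_pM2l ?invr_gt0//.
  apply: le_trans (ln_le_sum_inv N); rewrite -lnS ler_ln ?posrE// ?(ltW XN)//.
  exact: lt_le_trans ltr01 S1.
- by move=> k; exact: F0.
- move=> k kN; rewrite powRr1//.
  have kS : k.+1%:R <= Num.sqrt X by rewrite (le_trans _ NX)// ler_nat.
  have SXk : Num.sqrt X <= X / k.+1%:R by rewrite ler_pdivlMr// -{2}SS ler_wpM2l.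
  apply: (@le_trans _ _ ((digit_weight k / 2)%:E *
      (c * (ln X / 2) ^+ j / (X / k.+1%:R))%:E)%E).
    rewrite -EFinM lee_fin /D /digit_weight.
    rewrite (_ : _ / 2 * _ = c / (2 * X) * (ln X / 2) ^+ j * k.+2%:R^-1); last first.
      by field; rewrite !gt_eqF// -[_ + 1]natrD.
    rewrite ler_wpM2l// -invfM lef_pV2 ?posrE// ?mulr_gt0// -natrM ler_nat.
    by rewrite mul2n -addnn addSn addnS !ltnS leq_addr.
  have Xk0 : 0 < X / k.+1%:R by rewrite divr_gt0.
  apply: lee_pmul; rewrite ?lee_fin ?branch_length_ge//.
  + by rewrite divr_ge0// ltW// digit_weight_gt0.
  + by rewrite divr_ge0 ?(ltW Xk0)// mulr_ge0 ?(ltW c0)// exprn_ge0// divr_ge0.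
  + apply: le_trans (Hc _ _ (next_param_itv k g01) (le_trans S1 SXk)).
    rewrite lee_fin ler_wpM2r ?invr_ge0 ?(ltW Xk0)// ler_wpM2l ?(ltW c0)//.
    have lnXk : ln X / 2 <= ln (X / k.+1%:R).
      by rewrite -lnS ler_ln ?posrE// (lt_le_trans ltr01 S1).
    by rewrite lerXn2r ?nnegrE ?divr_ge0// (le_trans _ lnXk)// divr_ge0.
Qed.
End LowerBound.

(** * Blocks of digits and the zero-one law *)

Lemma infinite_set_natP (S : set nat) :
  infinite_set S <-> forall N, exists2 n, (N <= n)%N & S n.
Proof.
split=> [infS N|SN /finite_seqP[s Ss]].
  apply: contra_notP infS => NS; apply: sub_finite_set (finite_II N) => n Sn /=.
  by rewrite ltnNge; apply/negP => Nn; apply: NS; exists n.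
have [n sn] := SN (\max_(i <- s) i).+1.
by rewrite Ss /= => ns; have := leq_bigmax_seq (F := id) n ns isT; rewrite leqNgt sn.
Qed.

Lemma shift_seqD (i j : nat) (u : nat -> nat) :
  shift_seq i (shift_seq j u) = shift_seq (j + i) u.
Proof. by apply/funext => k; rewrite /shift_seq addnA. Qed.

Section Independence.
Context {R : realType}.
Implicit Types (g : R) (D : nat -> set (nat -> nat)) (b : nat -> R).

Lemma depends_on_first_blocks m d D :
  (forall i, depends_on_first m (D i)) ->
  depends_on_first (d * m) [set u | forall i, (i < d)%N -> ~ D i (shift_seq (i * m) u)].
Proof.
move=> dD u v uv Du i id Dv; apply: (Du i id); apply: (dD i _ _ _ Dv) => k km.
rewrite /shift_seq uv// (@leq_trans (i.+1 * m))//; last by rewrite leq_mul2r id orbT.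
by rewrite mulSn addnC ltn_add2r.
Qed.

(** Each avoided block contributes a factor at most 1 - b <= exp(- b), uniformly in the past, by
    [gauss_prob_indep]; the induction removes the first block and shifts the family. *)
Lemma gauss_prob_blocks m d D b g : 0 <= g <= 1 ->
    (forall i, depends_on_first m (D i)) ->
    (forall i g', 0 <= g' <= 1 -> ((b i)%:E <= gauss_prob g' (D i))%E) ->
  (gauss_prob g [set u | forall i, (i < d)%N -> ~ D i (shift_seq (i * m) u)] <=
   (expR (- \sum_(i < d) b i))%:E)%E.
Proof.
move=> g01; elim: d D b g g01 => [|d IHd] D b g g01 dD bD.
  rewrite big_ord0 oppr0 expR0; apply: (gauss_prob_le1 g01).
  exact: (@depends_on_first_blocks m 0).
pose F := [set u | forall i, (i < d)%N -> ~ D i.+1 (shift_seq (i * m) u)].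
have -> : [set u | forall i, (i < d.+1)%N -> ~ D i (shift_seq (i * m) u)] =
    ~` D 0%N `&` [set u | F (shift_seq m u)].
  apply/seteqP; split => u /=.
    move=> Du; split=> [|i id]; first exact: (Du 0%N).
    by rewrite shift_seqD -mulSn; exact: Du.
  by move=> [D0 Du] [_ //|i id]; rewrite mulSn -shift_seqD; exact: Du.
have FE g' : 0 <= g' <= 1 ->
    (gauss_prob g' F <= (expR (- \sum_(i < d) b i.+1))%:E)%E.
  by move=> g'01; apply: (IHd (D \o S) (b \o S)) => // i; [exact: dD|exact: bD].
have dF : depends_on_first (d * m) F.
  by apply: (@depends_on_first_blocks m d (D \o S)) => i; exact: dD.
apply: le_trans (gauss_prob_indep g01 (depends_on_firstC (dD 0%N)) dF FE) _.
rewrite big_ord_recl opprD addrC expRD EFinM lee_wpmul2l ?lee_fin ?expR_ge0//.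
rewrite (gauss_probC g01 (dD 0%N)).
apply: (@le_trans _ _ (1 - (b 0%N)%:E)%E); first by rewrite leeB// bD.
by rewrite -EFinB lee_fin (le_trans _ (expR_ge1Dx _)).
Qed.

Lemma eseries_pinfty_unbounded b : (forall n, 0 <= b n) ->
  (\sum_(n <oo) (b n)%:E = +oo)%E -> forall M, exists n, M <= \sum_(k < n) b k.
Proof.
move=> b0 boo M; apply: contrapT => NM.
suff : (\sum_(n <oo) (b n)%:E <= M%:E)%E by rewrite boo leye_eq.
apply: nneseries_le => [k|n]; first by rewrite lee_fin.
rewrite sumEFin lee_fin leNgt; apply/negP => Mn.
by apply: NM; exists n; exact: ltW.
Qed.

(* Pigeonhole over the residues modulo [m] of a long window starting at [N]. *)
Lemma residue_sum_ge m b : (0 < m)%N -> (forall n, 0 <= b n) ->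
  (\sum_(n <oo) (b n)%:E = +oo)%E ->
  forall T N, exists d r, T <= \sum_(i < d) b (N + r + i * m)%N.
Proof.
move=> m0 b0 /(eseries_pinfty_unbounded b0) bM T N.
have [n Hn] := bM (\sum_(k < N) b k + T *+ m).
have splitE p q : \sum_(k < p + q) b k = \sum_(k < p) b k + \sum_(k < q) b (p + k)%N.
  by rewrite big_split_ord.
have windowE d : \sum_(k < d * m) b (N + k)%N =
    \sum_(r < m) \sum_(i < d) b (N + r + i * m)%N.
  elim: d => [|d IHd].
    by rewrite big_ord0 big1// => r _; rewrite big_ord0.
  rewrite mulSn addnC big_split_ord /= IHd -big_split /=; apply: eq_bigr => r _.
  by rewrite big_ord_recr /= addnA addnAC.
have H : T *+ m <= \sum_(r < m) \sum_(i < n) b (N + r + i * m)%N.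
  rewrite -windowE -(lerD2l (\sum_(k < N) b k)) -splitE; apply: le_trans Hn _.
  have nN : (n <= N + n * m)%N by rewrite (leq_trans _ (leq_addl _ _))// leq_pmulr.
  by rewrite -(subnKC nN) splitE lerDl sumr_ge0.
apply: contrapT => NT; suff : \sum_(r < m) \sum_(i < n) b (N + r + i * m)%N < T *+ m.
  by rewrite ltNge H.
have -> : T *+ m = \sum_(r < m) T by rewrite sumr_const card_ord.
apply: ltr_sum => [|r _]; first by apply/hasP; exists (Ordinal m0); rewrite ?mem_index_enum.
by rewrite ltNge; apply/negP => TS; apply: NT; exists n, r.
Qed.

End Independence.

(** * Normalization of the exponents by the largest one *)

Section Normalization.
Context {R : realType}.
Implicit Types (s : seq R).

Lemma weighted_prodE s u :
  weighted_prod s u = \prod_(i < size s) (u i)%:R `^ s`_i.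
Proof.
elim: s u => [|x s IHs] u; first by rewrite big_ord0.
by rewrite /= big_ord_recl IHs.
Qed.

Lemma weighted_prod_ge0 s u : 0 <= weighted_prod s u.
Proof. by elim: s u => //= x s IHs u; rewrite mulr_ge0 ?powR_ge0. Qed.

Lemma weighted_prod_map_div s c u :
  weighted_prod [seq x / c | x <- s] u = weighted_prod s u `^ c^-1.
Proof.
elim: s u => [|x s IHs] u /=; first by rewrite powR1.
by rewrite IHs powRM ?powR_ge0 ?weighted_prod_ge0// powRrM.
Qed.

Lemma le_powRE (r x y : R) : 0 < r -> 0 <= x -> 0 <= y ->
  (x `^ r <= y `^ r) = (x <= y).
Proof.
move=> r0 x0 y0; apply/idP/idP => [|xy]; last by rewrite ge0_ler_powR// ltW.
by apply: contraTT; rewrite -!ltNge => yx; rewrite gt0_ltr_powR.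
Qed.

Lemma weighted_productE m (t : m.-tuple R) k x :
  weighted_product t k.+1 x = weighted_prod t (shift_seq k (digits x)).
Proof.
rewrite weighted_prodE size_tuple; apply: eq_bigr => i _.
by rewrite -tnth_nth.
Qed.

Lemma tnth_le_tmax m (t : m.-tuple R) i : tnth t i <= tmax t.
Proof. exact: (le_bigmax 0 (tnth t) i). Qed.

Lemma count_tmax m (t : m.-tuple R) : 0 < tmax t ->
  count_mem 1 [seq x / tmax t | x <- t] = tmax_mult t.
Proof.
move=> t0; rewrite count_map /tmax_mult cardE /enum_mem size_filter -enumT.
rewrite -[tval t in LHS]map_tnth_enum count_map; apply: eq_count => i /=.
by rewrite !inE /= -[X in _ == X](divff (lt0r_neq0 t0)) (can_eq (divfK (lt0r_neq0 t0))).
Qed.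

Lemma tmax_mult_gt0 m (t : m.-tuple R) : (0 < m)%N -> (forall i, 0 < tnth t i) ->
  (0 < tmax_mult t)%N.
Proof.
case: m t => // m t _ ht; rewrite /tmax_mult; apply/card_gt0P.
exists [arg max_(i > ord0) tnth t i]%O; rewrite inE; apply/eqP/esym.
by apply: bigmax_eq_arg => // i _; exact: ltW.
Qed.

(** At g = 0 the coordinate change is the identity, so the chain starts from Lebesgue measure
    itself. *)
Lemma digit_event0 S : digit_event 0 S = [set y : R | 0 < y <= 1 /\ S (digits y)].
Proof.
by apply/seteqP; split => y; rewrite /digit_event /= /moebius addr0 mul0r subr0 divr1.
Qed.
End Normalization.

(** * Assembly of the convergence and divergence halves *)

Theorem theorem1p4 (R : realType) (m : nat) (t : m.-tuple R) (Psi : nat -> R)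
    (hm : (0 < m)%N) (ht : forall i : 'I_m, 0 < tnth t i)
    (hPsi : forall n : nat, (0 < n)%N -> 1 <= Psi n) :
  (((1 < tmax_mult t)%N ->
      exists2 c : R, 1 < c & \forall n \near \oo, c <= Psi n) ->
   (weighted_series t Psi < +oo)%E ->
   lebesgue_measure (limsup_set t Psi) = 0%E) /\
  (weighted_series t Psi = +oo%E ->
   lebesgue_measure (limsup_set t Psi) = 1%E).
Proof.
have tm0 : 0 < tmax t by rewrite (lt_le_trans (ht (Ordinal hm)))// tnth_le_tmax.
have r0 : 0 < (tmax t)^-1 by rewrite invr_gt0.
set s := [seq x / tmax t | x <- t].
have size_s : size s = m by rewrite size_map size_tuple.
have s01 x : x \in s -> 0 <= x <= 1.
  move=> /mapP[_ /tnthP[i ->] ->]; rewrite divr_ge0 ?(ltW (ht i)) ?(ltW tm0)//=.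
  by rewrite ler_pdivrMr// mul1r tnth_le_tmax.
have cs := count_tmax tm0; rewrite -/s in cs.
have cs0 := tmax_mult_gt0 hm ht.
pose j := (tmax_mult t).-1.
pose X n : R := Psi n.+1 `^ (tmax t)^-1.
have P1 n : 1 <= Psi n.+1 by exact: hPsi.
have X1 n : 1 <= X n by rewrite -(powRr0 (Psi n.+1)) ler_powR// ltW.
have X0 n : 0 < X n := lt_le_trans ltr01 (X1 n).
have lnX n : ln (X n) = (tmax t)^-1 * ln (Psi n.+1) by rewrite ln_powR.
pose b n : R := ln (Psi n.+1) ^+ j / X n.
have b0 n : 0 <= b n by rewrite divr_ge0 ?exprn_ge0 ?ln_ge0// ltW.
have seriesE : weighted_series t Psi = (\sum_(n <oo) (b n)%:E)%E.
  (* The value 0 at index 0 makes all terms nonnegative, as [Psi 0] is unconstrained. *)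
  pose h n := if n is k.+1 then (b k)%:E else 0%E.
  rewrite /weighted_series (_ : (\sum_(1 <= n <oo) _)%E = (\sum_(1 <= n <oo) h n)%E).
    rewrite -nneseries_addn; last by case=> [|n]; rewrite ?lee_fin.
    by apply: eq_eseriesr => n _; rewrite addn1.
  by apply/congr_lim/funext => n; apply: eq_big_nat => -[].
pose A n : set (nat -> nat) := [set u | prod_event s (X n) (shift_seq n u)].
have dA n : depends_on_first (n + m) (A n).
  by apply: depends_on_first_shift; rewrite -size_s; exact: depends_on_first_prod_event.
pose F n : set R := digit_event 0 (A n).
have z01 : 0 <= (0 : R) <= 1 by rewrite lexx ler01.
have mF n : measurable (F n) := measurable_digit_event z01 (@dA n).
(* The set lives on [0, 1) and the events on (0, 1]; away from 0 and 1 the two limsup sets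
   coincide. *)
have [_ limsupE] : measurable (limsup_set t Psi) /\
    lebesgue_measure (limsup_set t Psi) = lebesgue_measure (lim_sup_set F).
  apply: (@lebesgue_measure_eq_mod_countable _ _ _ [set 0; 1]).
  - exact: finite_set_countable.
  - have AE x n : A n (digits x) <-> Psi n.+1 <= weighted_product t n.+1 x.
      rewrite /A /prod_event /= weighted_prod_map_div le_powRE ?weighted_prod_ge0//.
        by rewrite weighted_productE.
      by rewrite (le_trans ler01).
    apply/seteqP; split => x [Hx Nx]; split => //.
    + move: Hx => H; have x01 : 0 < x < 1.
        move: (H 0%N Logic.I) => [n _]; rewrite /F digit_event0 => -[/andP[x0 x1] _].
        by rewrite x0 lt_neqAle x1 andbT; apply/eqP => x1'; apply: Nx; right.
      have /andP[x0 x1] := x01; split; first by rewrite ltW.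
      apply/infinite_set_natP => N; have [n Nn] := H N Logic.I.
      rewrite /F digit_event0 => -[_ /AE AnX]; exists n.+1 => //.
      exact: leqW.
    + move: Hx => [/andP[x0 x1] /infinite_set_natP H] N _.
      have [[|n] Nn [// _ /AE Ax]] := H N.+1.
      exists n => //; rewrite /F digit_event0; split=> //.
      rewrite (ltW x1) andbT lt_neqAle x0 andbT; apply/eqP => x0'; apply: Nx.
      by left.
  - by apply: bigcap_measurableType => N _; apply: bigcup_measurable => n _.
rewrite limsupE seriesE; split => [hc bfin|boo].
- have [f [C [_ fP C0 fC]]] := prod_event_dominated s01.
  (* The domination is uniform in the parameter, so it also holds after [n] arbitrary digits. *)
  have FfX n : (lebesgue_measure (F n) <= (C * log_growth (X n) ^+ j / X n)%:E)%E.
    apply: (@gauss_prob_shift_le _ n _ (prod_event s (X n)) _ 0 z01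
      (@depends_on_first_prod_event _ s (X n))) => g g01.
    apply: le_trans (fP g _ g01 (X0 n)) _; move: fC; rewrite cs /j.
    by case: (tmax_mult t) cs0 => // i _ /(_ _ (X0 n)).
  have [K [n0 [K0 HK]]] : exists K n0, 0 <= K /\
      forall n, (n0 <= n)%N -> log_growth (X n) ^+ j <= K * ln (Psi n.+1) ^+ j.
    have [j0|j0] := posnP j.
      by exists 1, 0%N; split=> // n _; rewrite j0 !expr0 mulr1.
    have [|c c1 [n0 _ cP]] := hc; first by rewrite -(prednK cs0).
    have lnc : 0 < ln c by rewrite ln_gt0.
    (* Indeed 1 + ln (1 + X) <= 1 + ln 2 + ln X <= 2 + ln Psi / t_max, and 2 <= (2 / ln c) ln Psi
       once Psi >= c. *)
    pose K := 2 / ln c + (tmax t)^-1.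
    have K0 : 0 <= K by rewrite addr_ge0 ?divr_ge0// ltW.
    exists (K ^+ j), n0; split => [|n n0n]; first by rewrite exprn_ge0.
    have cPsi : c <= Psi n.+1 by apply: cP; exact: leqW.
    have c0 : 0 < c by rewrite (lt_trans ltr01).
    have lnPsi : ln c <= ln (Psi n.+1) by rewrite ler_ln ?posrE// (lt_le_trans c0).
    rewrite -exprMn lerXn2r ?nnegrE//.
    + by rewrite (le_trans ler01)// log_growth_ge1// ltW.
    + by rewrite mulr_ge0// ln_ge0.
    + have ln2 : ln 2 <= 1 :> R by apply: le_ln1Dx; lra.
      have : ln (1 + X n) <= ln (2 * X n).
        by rewrite ler_ln ?posrE ?mulr_gt0 ?addr_gt0//; have := X1 n; lra.
      rewrite lnM ?posrE// lnX => h.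
      have : 2 <= 2 / ln c * ln (Psi n.+1) by rewrite mulrAC ler_pdivlMr// ler_pM2l.
      by rewrite /log_growth /K mulrDl; lra.
  have CK0 : 0 <= C * K by rewrite mulr_ge0.
  (* Borel-Cantelli; the first [n0] terms, where the comparison may fail, have a finite sum. *)
  apply: lim_sup_set_cvg0 => //; rewrite (nneseries_split 0 n0)// add0n.
  rewrite lte_add_pinfty//.
    apply: lte_sum_pinfty => n _; apply: le_lt_trans (ltry 1).
    exact: (gauss_prob_le1 z01 (@dA n)).
  rewrite -nneseries_addn//.
  apply: (@le_lt_trans _ _ (\sum_(n <oo) (C * K)%:E * (b (n + n0)%N)%:E)%E).
    apply: lee_nneseries => // n _; apply: le_trans (FfX _) _.
    rewrite -EFinM lee_fin /b mulrA ler_wpM2r ?invr_ge0 ?(ltW (X0 _))//.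
    by rewrite -mulrA ler_wpM2l// HK// leq_addl.
  rewrite nneseriesZl; last by move=> n _; rewrite lee_fin.
  rewrite (nneseries_addn n0 (f := fun n => (b n)%:E)); last by move=> n; rewrite lee_fin.
  rewrite lte_mul_pinfty ?lee_fin//; apply: le_lt_trans bfin.
  rewrite [leRHS](nneseries_split 0 n0) ?add0n; last by move=> n _; rewrite lee_fin.
  by rewrite leeDr// sume_ge0// => n _; rewrite lee_fin.
- have [] := gauss_prob_prod_ge s01; first by rewrite cs.
  (* The extra factor turns (ln X)^j into (ln Psi)^j. *)
  move=> c c0 Hc; pose c' := c * (tmax t)^-1 ^+ j.
  have c'0 : 0 < c' by rewrite mulr_gt0// exprn_gt0.
  have bP n g : 0 <= g <= 1 -> ((c' * b n)%:E <= gauss_prob g (prod_event s (X n)))%E.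
    move=> g01; apply: le_trans (Hc g _ g01 (X1 n)); rewrite lee_fin cs lnX exprMn.
    by rewrite /c' /b -/j !mulrA.
  (* [G N] holds the points that avoid every event from index [N] on; these sets exhaust the
     complement of the limsup set in (0, 1]. *)
  pose G N := \bigcap_(n in [set n | (N <= n)%N]) (`]0, 1]%classic `\` F n).
  have mI : measurable (`]0, 1]%classic : set R) by [].
  have mG N : measurable (G N).
    by apply: bigcap_measurableType => n _; exact: measurableD.
  have G0 N : lebesgue_measure (G N) = 0%E.
    apply/eqP; rewrite -measure_le0; apply/lee_addgt0Pr => e e0; rewrite add0e.
    (* The target is chosen so that exp(- c' T) = e. *)
    have [d [r dr]] := residue_sum_ge hm b0 boo (- ln e / c') N.
    pose D i := prod_event s (X (N + r + i * m)%N).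
    have dD i : depends_on_first m (D i).
      by rewrite -size_s; exact: depends_on_first_prod_event.
    pose S := [set u | forall i, (i < d)%N -> ~ D i (shift_seq (i * m) u)].
    have SP g : 0 <= g <= 1 -> (gauss_prob g S <= e%:E)%E.
      move=> g01.
      have := gauss_prob_blocks d g01 dD (fun i => bP (N + r + i * m)%N).
      move=> /le_trans; apply; rewrite lee_fin -mulr_sumr -[leRHS]lnK ?posrE// ler_expR.
      by rewrite lerNl -ler_pdivrMl// mulrC.
    (* A point of [G N] avoids in particular the [d] disjoint blocks that start after N + r
       digits. *)
    apply: le_trans (gauss_prob_shift_le (N + r) z01 (depends_on_first_blocks dD) SP).
    apply: le_measure; rewrite ?inE; first exact: mG.
      exact: (measurable_digit_event z01
        (depends_on_first_shift (depends_on_first_blocks dD))).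
    rewrite digit_event0 => x Gx.
    have GN : (N <= N + r)%N by rewrite leq_addr.
    split; first by have [+ _] := Gx N (leqnn N); rewrite /= in_itv.
    move=> i id; rewrite shift_seqD => Dx.
    have Nn : (N <= N + r + i * m)%N by rewrite -addnA leq_addr.
    by have [x01 NF] := Gx _ Nn; apply: NF; rewrite /F digit_event0; split.
  have mL : measurable (lim_sup_set F).
    by apply: bigcap_measurableType => N _; apply: bigcup_measurable => n _.
  have mGU : measurable (\bigcup_N G N) by exact: bigcupT_measurable.
  have GU0 : lebesgue_measure (\bigcup_N G N) = 0%E.
    apply/(negligibleP lebesgue_measure mGU); apply: negligible_bigcup => N.
    by apply/(negligibleP lebesgue_measure (mG N))/G0.
  have cover : lim_sup_set F `|` \bigcup_N G N = `]0, 1]%classic.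
    apply/seteqP; split => x.
      move=> [H|[N _ H]]; last by have [] := H N (leqnn N).
      by have [n _] := H 0%N Logic.I; rewrite /F digit_event0 /= in_itv => -[].
    move=> x01; have [H|H] := pselect (lim_sup_set F x); [by left|right].
    apply: contrapT => NG; apply: H => N _; apply: contrapT => NF; apply: NG.
    by exists N => // n Nn; split => // Fn; apply: NF; exists n.
  transitivity (lebesgue_measure (lim_sup_set F `|` \bigcup_N G N)).
    by apply/esym/(measureU0 (mu := lebesgue_measure) mL mGU).
  by rewrite cover lebesgue_measure_itv /= lte_fin ltr01 oppr0 adde0.
Qed.
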